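(* Let $M$ be a compact $G$-stable submanifold of $Z$, let $\nu\in\mathscr P(M)$ and let $v\in\mathfrak p$ be a unit vector. Let $c_1>\dots>c_r$ be the critical values of $\mu_{\mathfrak p}^v:M\to\mathbb R$ and let $W_1,\dots,W_r$ be the corresponding unstable manifolds. Then $$\lambda_\nu(\mathrm e(-v))=\sum_{i=1}^r c_i\,\nu(W_i).$$
   Context: $U$ is a compact connected Lie group with Lie algebra $\mathfrak u$ and complexification $U^{\mathbb C}$. $(Z,\omega)$ is a Kähler manifold on which $U^{\mathbb C}$ acts holomorphically, $\omega$ is $U$-invariant, and $U$ acts in a Hamiltonian fashion with momentum map $\mu:Z\to\mathfrak u^*$: $\mu$ is $U$-equivariant and, for $\xi\in\mathfrak u$, the gradient of $\mu^\xi=\mu(\cdot)(\xi)$ is $J\xi_Z$, where $\xi_Z(p)=\frac{d}{dt}|_{t=0}\exp(t\xi)p$. $G\subset U^{\mathbb C}$ is a closed connected compatible subgroup: $G=K\exp(\mathfrak p)$ with $K=U\cap G$, $\mathfrak p=\mathfrak g\cap i\mathfrak u$, $\mathfrak g=\mathfrak k\oplus\mathfrak p$. A fixed $\mathrm{Ad}(U^{\mathbb C})$-invariant non-degenerate real bilinear form on $\mathfrak u^{\mathbb C}$, positive definite on $i\mathfrak u$, negative definite on $\mathfrak u$, with $\mathfrak u\perp i\mathfrak u$, gives a scalar product $\langle\cdot,\cdot\rangle$ on $\mathfrak p$ and a $G$-invariant Riemannian metric on $X=G/K$. The gradient map $\mu_{\mathfrak p}:M\to\mathfrak p$ is defined by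 $\langle\mu_{\mathfrak p}(z),\beta\rangle=-\mu(z)(i\beta)$ for $\beta\in\mathfrak p$; $\mu^v_{\mathfrak p}=\langle\mu_{\mathfrak p},v\rangle$. $\Psi^M:M\times G\to\mathbb R$ is the function such that, for each $x\in M$, $\Psi^M(x,e)=0$ and the differential of $\Psi^M(x,\cdot)$ at $g$ is $w\mapsto\langle\mu_{\mathfrak p}(gx),\pi_{\mathfrak p}(dR_{g^{-1}}w)\rangle$ for $w\in T_gG$, with $\pi_{\mathfrak p}:\mathfrak g\to\mathfrak p$ the projection along $\mathfrak k$ and $R$ right translation. $\mathscr P(M)$ is the set of Borel probability measures on $M$, and $\Psi^{\mathscr P}(\nu,g)=\int_M\Psi^M(x,g)\,d\nu(x)$. $\partial_\infty X$ is the set of equivalence classes of unit speed geodesic rays in $X$ (two rays being equivalent if they stay at bounded distance), and $\mathrm e:S(\mathfrak p)\to\partial_\infty X$ is the bijection from the unit sphere of $\mathfrak p$ sending $v$ to the class of $t\mapsto\exp(tv)K$. The maximal weight of $\nu$ is $\lambda_\nu:\partial_\infty X\to\mathbb R$, $\lambda_\nu(\mathrm e(v))=\lim_{t\to+\infty}\frac{d}{dt}\Psi^{\mathscr P}(\nu,\exp(-tv))$. For $x\in M$ the limit $\alpha(x)=\lim_{t\to+\infty}\exp(tv)x$ exists and is a critical point of $\mu_{\mathfrak p}^v$ ($\mu^v_{\mathfrak p}$ is a Morse-Bott function with finitely many critical values). $C_i$ is the set of critical points of $\mu_{\mathfrak p}^v$ with critical value $c_i$, and $W_i=\{x\in M:\alpha(x)\in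 C_i\}$. *)

(* Defs.v *)
From HB Require Import structures.
From mathcomp Require Import all_boot all_order all_algebra.
From mathcomp Require Import all_classical all_reals all_analysis.

Set Implicit Arguments.
Unset Strict Implicit.
Unset Printing Implicit Defensive.

Import Order.TTheory GRing.Theory Num.Theory.
Import numFieldNormedType.Exports.

Local Open Scope classical_set_scope.
Local Open Scope ring_scope.

Section Smooth.
Context {R : realType} {V W : normedModType R}.

Fixpoint Ck_on (k : nat) (A : set V) (f : V -> W) : Prop :=
  if k is k'.+1 then
    (forall x, A x -> differentiable f x) /\ (forall v, Ck_on k' A ('D_v f))
  else forall x, A x -> {for x, continuous f}.

(* Only meant for an open set [A]. *)
Definition smooth_on (A : set V) (f : V -> W) := forall k, Ck_on k A f.

End Smooth.

(* C^n is R^(2n) = 'rV[R]_(n + n), (x, y) standing for x + iy, with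
   multiplication by i given by [J]; holomorphic means smooth with a
   [J]-linear differential. *)

Notation model R n := 'rV[R]_(n + n).

Definition J {R : realType} {n : nat} (w : model R n) : model R n :=
  row_mx (- rsubmx w) (lsubmx w).

Record chart (R : realType) (V : normedModType R) (T : topologicalType) :=
  Chart {
    dom : set T;
    fwd : T -> V;
    bwd : V -> T;
    dom_open : open dom;
    codom_open : open (fwd @` dom);
    fwdK : forall x, dom x -> bwd (fwd x) = x;
    fwd_cont : forall x, dom x -> {for x, continuous fwd};
    bwd_cont : forall y, (fwd @` dom) y -> {for y, continuous bwd}
  }.

Definition smooth_change (R : realType) (V : normedModType R)
    (T : topologicalType) (a b : chart V T) :=
  smooth_on (fwd a @` (dom a `&` dom b)) (fwd b \o bwd a).

(* The atlas is the family of the [chart_at p].  The tangent space at p is the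
   model space, a vector being read in the preferred chart [chart_at p]. *)
Record complexManifold (R : realType) := ComplexManifold {
  carrier :> topologicalType;
  cdim : nat;
  chart_at : carrier -> chart (model R cdim) carrier;
  carrier_hausdorff : hausdorff_space carrier;
  carrier_second_countable : @second_countable carrier;
  mem_chart_at : forall p, dom (chart_at p) p;
  chart_at_smooth : forall p q, smooth_change (chart_at p) (chart_at q);
  chart_at_holo : forall p q x, dom (chart_at p) x -> dom (chart_at q) x ->
    let d := 'd (fwd (chart_at q) \o bwd (chart_at p)) (fwd (chart_at p) x) in
    forall u, d (J u) = J (d u)
}.

Definition tangent (R : realType) (N : complexManifold R) := model R (cdim N).

Section Manifolds.
Context {R : realType}.
Implicit Types N : complexManifold R.

Definition coord N (p : N) : N -> tangent N := fwd (chart_at p).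

(* The change of coordinates T_qN -> T_qN from the reading in the chart
   [chart_at p] to the reading in [chart_at q]. *)
Definition transition N (p q : N) (u : tangent N) : tangent N :=
  'd (coord q \o bwd (chart_at p)) (coord p q) u.

Definition mdiff (N1 N2 : complexManifold R) (f : N1 -> N2) (x : N1) (u : tangent N1) : tangent N2 :=
  'd (coord (f x) \o f \o bwd (chart_at x)) (coord x x) u.

Definition smooth_map (N1 N2 : complexManifold R) (f : N1 -> N2) :=
  continuous f /\
  forall p q, smooth_on (coord p @` (dom (chart_at p) `&` f @^-1` dom (chart_at q)))
                        (coord q \o f \o bwd (chart_at p)).

Definition holomorphic (N1 N2 : complexManifold R) (f : N1 -> N2) :=
  smooth_map f /\ forall x u, mdiff f x (J u) = J (mdiff f x u).

Definition local_rep2 (N1 N2 N3 : complexManifold R) (f : N1 -> N2 -> N3) (p : N1) (q : N2) (r : N3)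
    (w : (tangent N1 * tangent N2)%type) : tangent N3 :=
  coord r (f (bwd (chart_at p) w.1) (bwd (chart_at q) w.2)).

Definition holomorphic2 (N1 N2 N3 : complexManifold R) (f : N1 -> N2 -> N3) :=
  [/\ continuous (fun z : N1 * N2 => f z.1 z.2),
      forall p q r, smooth_on
        [set w | exists z : N1 * N2,
           [/\ dom (chart_at p) z.1, dom (chart_at q) z.2,
               dom (chart_at r) (f z.1 z.2) & w = (coord p z.1, coord q z.2)]]
        (local_rep2 f p q r)
    & forall x y,
        let d := 'd (local_rep2 f x y (f x y)) (coord x x, coord y y) in
        forall u1 u2, d (J u1, J u2) = J (d (u1, u2))].

Definition smooth_fun N (f : N -> R) :=
  forall p, smooth_on (coord p @` dom (chart_at p)) (f \o bwd (chart_at p)).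

Definition fun_diff N (f : N -> R) (x : N) (u : tangent N) : R :=
  'd (f \o bwd (chart_at x)) (coord x x) u.

Definition smooth_curve N (gamma : R -> N) :=
  continuous gamma /\
  forall p, smooth_on (gamma @^-1` dom (chart_at p)) (coord p \o gamma).

Definition velocity N (gamma : R -> N) (t : R) : tangent N :=
  derive1 (coord (gamma t) \o gamma) t.

(* Embedded submanifold: slice charts; the dimension may depend on the
   connected component. *)
Definition submanifold N (M : set N) :=
  forall x, M x -> exists c : chart (model R (cdim N)) N,
    [/\ dom c x,
        forall p, smooth_change c (chart_at p) /\ smooth_change (chart_at p) c
      & exists A : 'M[R]_(cdim N + cdim N),
          forall y, dom c y -> (M y <-> fwd c y *m A = 0)].

(* [l] is the differential at [x] of the restriction of [f] to the submanifold
   [S], whose tangent vectors are the velocities of the curves in [S]. *)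
Definition has_differential_on N (S : set N) (f : N -> R) (x : N)
    (l : tangent N -> R) :=
  forall gamma : R -> N, smooth_curve gamma -> (forall t, S (gamma t)) ->
    gamma 0 = x -> is_derive (0 : R) 1 (f \o gamma) (l (velocity gamma 0)).

Definition critical_on N (S : set N) (f : N -> R) (x : N) :=
  S x /\ has_differential_on S f x (fun=> 0).

Definition local_form N (omega : N -> tangent N -> tangent N -> R) (p : N)
    (u w : tangent N) (y : tangent N) : R :=
  let q := bwd (chart_at p) y in
  omega q (transition p q u) (transition p q w).

Definition kahler_metric N (omega : N -> tangent N -> tangent N -> R)
    (z : N) (u w : tangent N) : R := omega z u (J w).

Record kahler_form N (omega : N -> tangent N -> tangent N -> R) : Prop := {
  form_linear : forall z a u1 u2 w,
    omega z (a *: u1 + u2) w = a * omega z u1 w + omega z u2 w;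
  form_alternating : forall z u w, omega z w u = - omega z u w;
  form_smooth : forall p u w,
    smooth_on (coord p @` dom (chart_at p)) (local_form omega p u w);
  form_closed : forall p y u v w, (coord p @` dom (chart_at p)) y ->
    'D_u (local_form omega p v w) y + 'D_v (local_form omega p w u) y
      + 'D_w (local_form omega p u v) y = 0;
  form_J_invariant : forall z u w, omega z (J u) (J w) = omega z u w;
  form_positive : forall z u, u != 0 -> 0 < kahler_metric omega z u u
}.

End Manifolds.

Record complexLieGroup (R : realType) := ComplexLieGroup {
  lie_manifold :> complexManifold R;
  gmul : lie_manifold -> lie_manifold -> lie_manifold;
  ginv : lie_manifold -> lie_manifold;
  gone : lie_manifold;
  gmulA : associative gmul;
  gmul1 : left_id gone gmul;
  gmulV : left_inverse gone ginv gmul;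
  gmul_holo : holomorphic2 gmul;
  ginv_holo : holomorphic ginv
}.

Arguments gone {R}.

(* Read in the chart [chart_at (gone H)] at the identity. *)
Definition lie (R : realType) (H : complexLieGroup R) := tangent H.

Section LieGroups.
Context {R : realType}.
Implicit Types H : complexLieGroup R.

Definition subgroup H (S : set H) :=
  [/\ S (gone H), forall a b, S a -> S b -> S (gmul a b)
    & forall a, S a -> S (ginv a)].

Definition holomorphic_hom (H1 H2 : complexLieGroup R) (f : H1 -> H2) :=
  holomorphic f /\ forall a b, f (gmul a b) = gmul (f a) (f b).

(* [H] is the universal complexification of its compact subgroup [U]; recall
   that continuous homomorphisms of Lie groups are smooth. *)
Definition complexification H (U : set H) :=
  forall (H' : complexLieGroup R) (phi : H -> H'),
    {within U, continuous phi} ->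
    (forall a b, U a -> U b -> phi (gmul a b) = gmul (phi a) (phi b)) ->
    exists! f : H -> H', holomorphic_hom f /\ forall a, U a -> f a = phi a.

Definition exponential_map H (expo : lie H -> H) :=
  forall xi,
    [/\ smooth_curve (fun t : R => expo (t *: xi)),
        forall s t : R, expo ((s + t) *: xi) = gmul (expo (s *: xi)) (expo (t *: xi))
      & velocity (fun t : R => expo (t *: xi)) 0 = xi].

(* The Lie algebra of a closed subgroup. *)
Definition lie_alg H (expo : lie H -> H) (S : set H) : set (lie H) :=
  [set xi | forall t : R, S (expo (t *: xi))].

Definition Ad H (g : H) : lie H -> lie H :=
  mdiff (fun h => gmul (gmul g h) (ginv g)) (gone H).

Definition holomorphic_action H (Z : complexManifold R) (act : H -> Z -> Z) :=
  [/\ forall z, act (gone H) z = z,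
      forall g h z, act (gmul g h) z = act g (act h z)
    & holomorphic2 act].

Definition fundamental_field H (expo : lie H -> H) (Z : complexManifold R)
    (act : H -> Z -> Z) (xi : lie H) (z : Z) : tangent Z :=
  velocity (fun t : R => act (expo (t *: xi)) z) 0.

Definition invariant_form H (U : set H) (Z : complexManifold R)
    (act : H -> Z -> Z) (omega : Z -> tangent Z -> tangent Z -> R) :=
  forall k z u w, U k ->
    omega (act k z) (mdiff (act k) z u) (mdiff (act k) z w) = omega z u w.

(* The values of [mu] are linear forms on the Lie algebra of [U]; what
   [mu z] is outside this real subspace of [lie H] is irrelevant. *)
Record momentum_map H (expo : lie H -> H) (U : set H) (Z : complexManifold R)
    (act : H -> Z -> Z) (omega : Z -> tangent Z -> tangent Z -> R)
    (mu : Z -> lie H -> R) : Prop := {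
  momentum_linear : forall z a xi eta, lie_alg expo U xi -> lie_alg expo U eta ->
    mu z (a *: xi + eta) = a * mu z xi + mu z eta;
  momentum_smooth : forall xi, lie_alg expo U xi -> smooth_fun (mu ^~ xi);
  momentum_equivariant : forall k z xi, U k -> lie_alg expo U xi ->
    mu (act k z) (Ad k xi) = mu z xi;
  momentum_gradient : forall xi z w, lie_alg expo U xi ->
    fun_diff (mu ^~ xi) z w =
      kahler_metric omega z (J (fundamental_field expo act xi z)) w
}.

Record invariant_bilinear_form H (expo : lie H -> H) (U : set H)
    (B : lie H -> lie H -> R) : Prop := {
  bil_linear : forall a x y z, B (a *: x + y) z = a * B x z + B y z;
  bil_sym : forall x y, B x y = B y x;
  bil_Ad : forall g x y, B (Ad g x) (Ad g y) = B x y;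
  bil_nondegenerate : forall x, (forall y, B x y = 0) -> x = 0;
  bil_neg : forall x, lie_alg expo U x -> x != 0 -> B x x < 0;
  bil_pos : forall x, lie_alg expo U x -> x != 0 -> 0 < B (J x) (J x);
  bil_orth : forall x y, lie_alg expo U x -> lie_alg expo U y -> B x (J y) = 0
}.

Section Compatible.
Variables (H : complexLieGroup R) (expo : lie H -> H) (U G : set H).

Definition K_of : set H := U `&` G.

Definition frak_k : set (lie H) := lie_alg expo K_of.

Definition frak_p : set (lie H) :=
  lie_alg expo G `&` [set J xi | xi in lie_alg expo U].

Definition compatible :=
  [/\ G = [set gmul k (expo b) | k in K_of & b in frak_p],
      lie_alg expo G = [set a + b | a in frak_k & b in frak_p]
    & frak_k `&` frak_p = [set 0]].

(* The projection g -> p along k. *)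
Definition pi_p (w : lie H) : lie H :=
  xget 0 [set b | frak_p b /\ frak_k (w - b)].

Variable B : lie H -> lie H -> R.

Definition unit_p : set (lie H) := [set w | frak_p w /\ B w w = 1].

Definition coset (g : H) : set H := [set gmul g k | k in K_of].

Definition sym_space : set (set H) := [set coset g | g in G].

(* The projection G -> X = G/K identifies T_{gK}X with p through left
   translation by g; the invariant metric is the one making this isometric.
   Curves in X are projections of curves in G. *)
Definition speed (gamma : R -> H) (t : R) : R :=
  let w := pi_p (mdiff (gmul (ginv (gamma t))) (gamma t) (velocity gamma t)) in
  Num.sqrt (B w w).

Definition curve_length (gamma : R -> H) : R :=
  Rintegral (@lebesgue_measure R) `[0, 1]%classic (speed gamma).

Definition sym_dist (a b : set H) : R :=
  inf [set curve_length gamma | gamma in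
    [set gamma | [/\ smooth_curve gamma, forall t, G (gamma t),
                     a (gamma 0) & b (gamma 1)]]].

(* Rays are parametrized by [0, +oo[; values at negative times are irrelevant.
   As X is a Hadamard manifold, the geodesics are the isometric embeddings. *)
Definition geodesic_ray (c : R -> set H) :=
  (forall t, 0 <= t -> sym_space (c t)) /\
  (forall s t, 0 <= s -> 0 <= t -> sym_dist (c s) (c t) = `|s - t|).

Definition asymptotic (c c' : R -> set H) :=
  exists D : R, forall t, 0 <= t -> sym_dist (c t) (c' t) <= D.

Definition ray_class (c : R -> set H) : set (R -> set H) :=
  [set c' | geodesic_ray c' /\ asymptotic c c'].

Definition boundary : set (set (R -> set H)) :=
  [set ray_class c | c in geodesic_ray].

Definition boundary_param (e : lie H -> boundary) :=
  forall w, unit_p w -> val (e w) = ray_class (fun t => coset (expo (t *: w))).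

End Compatible.

Section GradientMap.
Variables (H : complexLieGroup R) (expo : lie H -> H) (U G : set H).
Variables (B : lie H -> lie H -> R) (Z : complexManifold R).
Variables (act : H -> Z -> Z) (mu : Z -> lie H -> R) (M : set Z).

Definition gradient_map (mup : Z -> lie H) :=
  forall z, M z -> frak_p expo U G (mup z) /\
    forall b, frak_p expo U G b -> B (mup z) b = - mu z (J b).

Definition kempf_ness (mup : Z -> lie H) (Psi : Z -> H -> R) :=
  forall x, M x -> Psi x (gone H) = 0 /\
    forall g, G g ->
      has_differential_on G (Psi x) g (fun w =>
        B (mup (act g x))
          (pi_p expo U G (mdiff (fun h => gmul h (ginv g)) g w))).

End GradientMap.

End LieGroups.

(* Measurable types are pointed in the library, hence the base point in the
   measurable space [borel x0] of the subspace [M]. *)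

Definition pointed_sub (T : topologicalType) (M : set T) (x0 : M) : Type := M.

HB.instance Definition _ (T : topologicalType) (M : set T) (x0 : M) :=
  Topological.copy (pointed_sub x0) (set_type M).
HB.instance Definition _ (T : topologicalType) (M : set T) (x0 : M) :=
  isPointed.Build (pointed_sub x0) x0.

Notation borel x0 := (g_sigma_algebraType (@open (pointed_sub x0))).

Section MaximalWeight.
Context {R : realType}.
Variables (H : complexLieGroup R) (expo : lie H -> H) (U G : set H).
Variables (B : lie H -> lie H -> R) (Z : complexManifold R) (M : set Z) (x0 : M).
Variables (Psi : Z -> H -> R) (nu : probability (borel x0) R).

Definition PsiP (g : H) : R :=
  Rintegral nu setT (fun x : borel x0 => Psi (val (x : M)) g).

(* As e is a bijection, this determines the function [lambda]. *)
Definition maximal_weight (e : lie H -> boundary expo U G B)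
    (lambda : boundary expo U G B -> R) :=
  forall w, unit_p expo U G B w ->
    lambda (e w) =
      lim (derive1 (fun t : R => PsiP (expo (- t *: w))) t @[t --> +oo]).

End MaximalWeight.

Section Unstable.
Context {R : realType}.
Variables (H : complexLieGroup R) (expo : lie H -> H).
Variables (Z : complexManifold R) (act : H -> Z -> Z) (M : set Z) (x0 : M).

Definition limit_map (v : lie H) (alpha : M -> M) :=
  forall x : M, act (expo (t *: v)) (val x) @[t --> +oo] --> (val (alpha x) : Z).

Definition crit_level (f : Z -> R) (c : R) : set Z :=
  [set y | critical_on M f y /\ f y = c].

Definition unstable (f : Z -> R) (alpha : M -> M) (c : R) : set (borel x0) :=
  [set x : M | crit_level f c (val (alpha x))].

End Unstable.

(* Main.v *)
(* Along the flow of v the derivative of t |-> Psi(x, exp(tv)) is f(exp(tv)x) with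
   f = mu_p^v, which is bounded on the compact set M and tends to f(alpha(x)).
   Differentiating under the integral sign and letting t tend to infinity by
   dominated convergence gives lambda_nu(e(-v)) as the integral of f o alpha.
   The point alpha(x) is fixed by the flow, so the field J v_Z, which is the
   gradient of f up to sign, vanishes there: f o alpha takes only critical
   values, and it takes the value c_i exactly on W_i. *)

Require Import Defs.
From mathcomp Require Import all_boot all_order all_algebra.
From mathcomp Require Import all_classical all_reals all_analysis measurable_realfun.

Import Order.TTheory GRing.Theory Num.Theory.
Import numFieldNormedType.Exports.

Local Open Scope classical_set_scope.
Local Open Scope ring_scope.

Set Implicit Arguments.
Unset Strict Implicit.

Local Notation coord := Defs.coord.

(** * Calculus under translation of the variable *)

Section Calculus.
Context {R : realType}.

Lemma derive_translate (V W : normedModType R) (f : V -> W) (a v x : V) :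
  'D_v (f \o shift a) x = 'D_v f (x + a).
Proof.
rewrite /derive /=.
by under [in LHS]eq_fun do rewrite -addrA.
Qed.

Lemma Ck_on_translate (V W : normedModType R) k (A : set V) (f : V -> W) a :
  Ck_on k A f -> Ck_on k (shift a @^-1` A) (f \o shift a).
Proof.
elim: k f => [f fA x /= Ax|k IH f [df kf] /=].
  apply: continuous_comp; last exact: fA.
  by apply: cvgD; [exact: cvg_id|exact: cvg_cst].
split=> [x Ax|v]; last first.
  rewrite (_ : 'D_v _ = 'D_v f \o shift a); first exact: IH (kf v).
  by apply/funext => x; exact: derive_translate.
apply: differentiable_comp; last exact: df.
by case: (is_diffD (is_diff_id x) (is_diff_cst a x)).
Qed.

Lemma smooth_on_differentiable (V W : normedModType R) (A : set V) (f : V -> W) x :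
  smooth_on A f -> A x -> differentiable f x.
Proof. by move=> /(_ 1%N)[df _]; exact: df. Qed.

End Calculus.

(** * Curves, velocities and differentials read in charts *)

Section Charts.
Context {R : realType}.
Implicit Types N : complexManifold R.

Lemma coordK N (x : N) : bwd (chart_at x) (coord x x) = x.
Proof. exact/fwdK/mem_chart_at. Qed.

Lemma near_coordK N (gamma : R -> N) (t : R) : {for t, continuous gamma} ->
  \forall s \near t, bwd (chart_at (gamma t)) (coord (gamma t) (gamma s)) = gamma s.
Proof.
move=> cg; have : \forall s \near t, dom (chart_at (gamma t)) (gamma s).
  apply: cg; apply: open_nbhs_nbhs; split; first exact: dom_open.
  exact: mem_chart_at.
by apply: filterS => s; exact: fwdK.
Qed.

Lemma smooth_curve_translate N (gamma : R -> N) (a : R) :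
  smooth_curve gamma -> smooth_curve (gamma \o shift a).
Proof.
move=> [cg sg]; split=> [t|p k].
  apply: continuous_comp; last exact: cg.
  by apply: cvgD; [exact: cvg_id|exact: cvg_cst].
exact: (Ck_on_translate a (sg p k)).
Qed.

(** Both velocities are read in the same chart, the one at [gamma (t + a)]. *)
Lemma velocity_translate N (gamma : R -> N) (a t : R) :
  velocity (gamma \o shift a) t = velocity gamma (t + a).
Proof.
rewrite /velocity !derive1E.
by rewrite -[LHS]/('D_1 ((coord (gamma (t + a)) \o gamma) \o shift a) t)
  derive_translate.
Qed.

Lemma smooth_curve_differentiable N (gamma : R -> N) (t : R) :
  smooth_curve gamma -> differentiable (coord (gamma t) \o gamma) t.
Proof.
by case=> _ /(_ (gamma t)) /smooth_on_differentiable; apply; exact: mem_chart_at.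
Qed.

(** For times near [t] the curve stays in the domain of the chart at [gamma t], so [F \o gamma] is
    there a composite of maps between normed spaces and the usual chain rule applies. *)
Lemma chain_rule_curve N (W : normedModType R) (F : N -> W) (gamma : R -> N)
    (t : R) :
  smooth_curve gamma ->
  differentiable (F \o bwd (chart_at (gamma t))) (coord (gamma t) (gamma t)) ->
  is_derive t (1 : R) (F \o gamma)
    ('d (F \o bwd (chart_at (gamma t))) (coord (gamma t) (gamma t)) (velocity gamma t)).
Proof.
move=> sg dF; have dg := smooth_curve_differentiable t sg.
have near_eq : \forall s \near t,
    ((F \o bwd (chart_at (gamma t))) \o (coord (gamma t) \o gamma)) s = (F \o gamma) s.
  by apply: filterS (near_coordK (proj1 sg t)) => s /= ->.
apply: near_eq_is_derive near_eq _.
have dFg : differentiable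
    ((F \o bwd (chart_at (gamma t))) \o (coord (gamma t) \o gamma)) t.
  exact: differentiable_comp.
apply: DeriveDef; first exact: diff_derivable.
by rewrite deriveE // diff_comp //= /velocity derive1E deriveE.
Qed.

Lemma velocity_comp {N1 N2 : complexManifold R} (f : N1 -> N2) (gamma : R -> N1)
    (t : R) :
  smooth_curve gamma ->
  differentiable (coord (f (gamma t)) \o f \o bwd (chart_at (gamma t)))
    (coord (gamma t) (gamma t)) ->
  velocity (f \o gamma) t = mdiff f (gamma t) (velocity gamma t).
Proof.
move=> sg df; rewrite /velocity derive1E.
by have [_ ->] := chain_rule_curve sg df.
Qed.

Section TwoVariables.
Context {N1 N2 N3 : complexManifold R} (f : N1 -> N2 -> N3).
Hypothesis holo_f : holomorphic2 f.
Variables (x : N1) (y : N2).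

Let rep := local_rep2 f x y (f x y).
Let base := (coord x x, coord y y).

Let slice : coord (f x y) \o f ^~ y \o bwd (chart_at x) =
  rep \o (fun u => (u, coord y y)).
Proof. by apply/funext => u; rewrite /rep /local_rep2 /= coordK. Qed.

Let rep_diff : differentiable rep base.
Proof.
have [_ /(_ x y (f x y)) sf _] := holo_f.
apply: smooth_on_differentiable sf _.
by exists (x, y); split=> //; exact: mem_chart_at.
Qed.

Let pair_diff : is_diff (coord x x) (fun u : tangent N1 => (u, coord y y))
  (fun u => (u, 0)).
Proof. exact: (is_diff_pair (is_diff_id _) (is_diff_cst _ _)). Qed.

Lemma holomorphic2_diffl :
  differentiable (coord (f x y) \o f ^~ y \o bwd (chart_at x)) (coord x x).
Proof.
by rewrite slice; apply: differentiable_comp; case: pair_diff.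
Qed.

(** Fixing the second variable evaluates the joint differential on pairs [(w, 0)]; since [J 0 = 0],
    its compatibility with [J] passes to the slice. *)
Lemma mdiff_holomorphic2l u : mdiff (f ^~ y) x (J u) = J (mdiff (f ^~ y) x u).
Proof.
have E w : mdiff (f ^~ y) x w = 'd rep base (w, 0).
  rewrite /mdiff slice diff_comp; [|by case: pair_diff|exact: rep_diff].
  by rewrite /comp; case: pair_diff => _ ->.
have J0 : J 0 = 0 :> tangent N2 by rewrite /J !linear0 row_mx0.
have [_ _ /(_ x y u 0)] := holo_f.
by rewrite !E J0.
Qed.

End TwoVariables.
End Charts.

(** Differentials on a submanifold are tested on curves at time 0 only; this carries the resulting
    derivative to an arbitrary time. *)
Lemma is_derive_translate {R : realType} (V W : normedModType R) (f : V -> W)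
    (a v x : V) (l : W) :
  is_derive x v (f \o shift a) l -> is_derive (x + a) v f l.
Proof.
move=> [df dl]; split; last by rewrite -derive_translate.
by move: df; rewrite /derivable /=; under eq_fun do rewrite -addrA.
Qed.

Lemma smooth_fun_continuous {R : realType} (N : complexManifold R) (f : N -> R) :
  smooth_fun f -> continuous f.
Proof.
move=> sf x; have near_f : \forall y \near x,
    ((f \o bwd (chart_at x)) \o coord x) y = f y.
  have : \forall y \near x, dom (chart_at x) y.
    apply: open_nbhs_nbhs; split; [exact: dom_open|exact: mem_chart_at].
  by apply: filterS => y /= /fwdK ->.
have fx := nbhs_singleton near_f.
rewrite /continuous_at -[X in _ --> X]fx.
apply: cvg_trans (near_eq_cvg near_f) _.
apply: (@continuous_comp _ _ _ (coord x) (f \o bwd (chart_at x))).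
  exact/fwd_cont/mem_chart_at.
apply: (sf x 0%N); exists x => //; exact: mem_chart_at.
Qed.

Lemma is_derive_smooth_fun {R : realType} (N : complexManifold R) (f : N -> R)
    (gamma : R -> N) (t : R) :
  smooth_fun f -> smooth_curve gamma ->
  is_derive t (1 : R) (f \o gamma) (fun_diff f (gamma t) (velocity gamma t)).
Proof.
move=> sf sg; apply: chain_rule_curve => //.
apply: smooth_on_differentiable (sf (gamma t)) _.
by exists (gamma t) => //; exact: mem_chart_at.
Qed.

(** * One-parameter subgroups and the flows they generate *)

Section ExponentialMap.
Context {R : realType} {H : complexLieGroup R}.

Lemma gmul_invr (g : H) : gmul g (ginv g) = gone H.
Proof.
rewrite -[LHS]gmul1 -{1}(gmulV (ginv g)) -gmulA [gmul (ginv g) (gmul _ _)]gmulA.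
by rewrite gmulV gmul1 gmulV.
Qed.

Lemma gmulr1 (g : H) : gmul g (gone H) = g.
Proof. by rewrite -(gmulV g) gmulA gmul_invr gmul1. Qed.

Variables (expo : lie H -> H).
Hypothesis exp_expo : exponential_map expo.

Let expoD xi (s t : R) :
  expo ((s + t) *: xi) = gmul (expo (s *: xi)) (expo (t *: xi)).
Proof. by have [] := exp_expo xi. Qed.

Lemma smooth_expo xi : smooth_curve (fun t : R => expo (t *: xi)).
Proof. by have [] := exp_expo xi. Qed.

(** By additivity this element is idempotent, and a group has no idempotent but its identity. *)
Lemma expo0 xi : expo ((0 : R) *: xi) = gone H.
Proof.
have := expoD xi 0 0; rewrite addr0; set g := expo _ => gg.
by rewrite -[LHS]gmul1 -(gmulV g) -gmulA -gg.
Qed.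

(** Right translation by the inverse of [expo (t *: xi)] turns the one-parameter subgroup into
    [expo ((s - t) *: xi)], whose velocity at [s = t] is the initial velocity [xi]. *)
Lemma right_trivialized_velocity_expo xi (t : R) :
  mdiff (fun h => gmul h (ginv (expo (t *: xi)))) (expo (t *: xi))
    (velocity (fun s : R => expo (s *: xi)) t) = xi.
Proof.
have sv := smooth_expo xi.
pose f h := gmul h (ginv (expo (t *: xi))).
have df := holomorphic2_diffl (gmul_holo H) (expo (t *: xi)) (ginv (expo (t *: xi))).
rewrite -(velocity_comp (f := f) sv df).
have -> : f \o (fun s : R => expo (s *: xi)) =
    (fun s : R => expo (s *: xi)) \o shift (- t).
  apply/funext => s; rewrite /f /= -[s in LHS](subrK t) expoD -gmulA gmul_invr.
  exact: gmulr1.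
rewrite velocity_translate subrr.
by have [_ _ ->] := exp_expo xi.
Qed.

Lemma lie_alg_opp (S : set H) xi : lie_alg expo S xi -> lie_alg expo S (- xi).
Proof. by move=> Sxi t; rewrite scalerN -scaleNr; exact: Sxi. Qed.

Variables (Z : complexManifold R) (act : H -> Z -> Z).
Hypothesis holo_act : holomorphic_action act.

Lemma fundamental_field_mdiff xi z :
  fundamental_field expo act xi z = mdiff (act ^~ z) (gone H) xi.
Proof.
have [_ _ holo2] := holo_act.
have df := holomorphic2_diffl holo2 (expo ((0 : R) *: xi)) z.
rewrite /fundamental_field (velocity_comp (f := act ^~ z) (smooth_expo xi) df).
by rewrite expo0; have [_ _ ->] := exp_expo xi.
Qed.

(** The field at [z] is the value at [xi] of the differential at the identity of the orbit map
    [act ^~ z], and this differential is [J]-linear. *)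
Lemma fundamental_fieldJ xi z :
  fundamental_field expo act (J xi) z = J (fundamental_field expo act xi z).
Proof.
have [_ _ holo2] := holo_act.
by rewrite !fundamental_field_mdiff mdiff_holomorphic2l.
Qed.

(** A time shift by [s] keeps the limit [y]; by additivity and continuity of the action the shifted
    flow also tends to the image of [y] at time [s]. Limits in a Hausdorff space are unique. *)
Lemma flow_limit_fixed xi (x y : Z) (s : R) :
  act (expo (t *: xi)) x @[t --> +oo] --> y -> act (expo (s *: xi)) y = y.
Proof.
move=> xy; have [_ actA [ca _ _]] := holo_act.
have hZ : hausdorff_space Z by exact: carrier_hausdorff.
have y1 : act (expo ((t + s) *: xi)) x @[t --> +oo] --> y.
  by move: xy; rewrite -(cvg_shiftr s).
suff y2 : act (expo ((t + s) *: xi)) x @[t --> +oo] --> act (expo (s *: xi)) y.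
  exact: (cvg_unique hZ y2 y1).
have -> : (fun t : R => act (expo ((t + s) *: xi)) x) =
    (fun t : R => act (expo (s *: xi)) (act (expo (t *: xi)) x)).
  by apply/funext => t; rewrite addrC expoD actA.
apply: (@cvg_comp _ _ _ (fun t : R => act (expo (t *: xi)) x) _ _ _ _ xy).
apply: (@continuous_comp _ _ _ (fun z => (expo (s *: xi), z)) (fun w => act w.1 w.2)).
  by apply: cvg_pair; [exact: cvg_cst|exact: cvg_id].
exact: ca.
Qed.



Lemma continuous_flow xi :
  continuous (fun w : R * Z => act (expo (w.1 *: xi)) w.2).
Proof.
move=> w; have [_ _ [ca _ _]] := holo_act.
apply: (@continuous_comp _ _ _ (fun w : R * Z => (expo (w.1 *: xi), w.2))
  (fun w => act w.1 w.2)); last exact: ca.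
apply: cvg_pair; last exact: cvg_snd.
apply: (@continuous_comp _ _ _ fst (fun t : R => expo (t *: xi))).
  exact: cvg_fst.
exact: (proj1 (smooth_expo xi)).
Qed.

End ExponentialMap.

Lemma JJ {R : realType} n (w : model R n) : J (J w) = - w.
Proof.
by rewrite /J row_mxKl row_mxKr -opp_row_mx hsubmxK.
Qed.

(** * The gradient map and the derivative of the Kempf-Ness function *)

Section GradientMap.
Context {R : realType} {UC : complexLieGroup R} {expo : lie UC -> UC}.
Hypothesis exp_expo : exponential_map expo.
Variables (U G : set UC) (B : lie UC -> lie UC -> R).
Hypothesis HB : invariant_bilinear_form expo U B.

Let Bl x y z : B (x - y) z = B x z - B y z.
Proof. by rewrite addrC -scaleN1r (bil_linear HB) mulN1r addrC. Qed.

Let BN x z : B (- x) z = - B x z.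
Proof. by rewrite -[- x]add0r Bl -{1}[0](subrr x) Bl subrr sub0r. Qed.

Lemma frak_p_opp w : frak_p expo U G w -> frak_p expo U G (- w).
Proof.
move=> [Gw [xi Uxi Jxi]]; split; first exact: (lie_alg_opp Gw).
exists (- xi); first exact: (lie_alg_opp Uxi).
by rewrite -Jxi /J !linearN opp_row_mx.
Qed.

Lemma unit_p_opp w : unit_p expo U G B w -> unit_p expo U G B (- w).
Proof.
move=> [pw Bw]; split; first exact: frak_p_opp.
by rewrite BN (bil_sym HB) BN opprK.
Qed.

(** This makes [J w] a legitimate argument of the momentum map, whose properties hold on the Lie
    algebra of [U] only. *)
Lemma lie_alg_J w : frak_p expo U G w -> lie_alg expo U (J w).
Proof. by move=> [_ [xi Uxi <-]]; rewrite JJ; exact: (lie_alg_opp Uxi). Qed.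

(* [B] is definite on [u], which is [B]-orthogonal to [p], so the component
   along [p] is unique without knowing that [lie_alg expo G] is a subspace. *)
Lemma pi_p_id w : subgroup G -> subgroup U -> frak_p expo U G w -> pi_p expo U G w = w.
Proof.
move=> [G1 _ _] [U1 _ _] pw; rewrite /pi_p.
have k0 : frak_k expo U G 0.
  by move=> t; rewrite scaler0 -(scaler0 _ 0) expo0.
case: xgetP => [b _ [pb kwb]|/(_ w) []]; last by split; rewrite ?subrr.
apply/esym/eqP; rewrite -subr_eq0; apply/negPn/negP => wb0.
have Uwb : lie_alg expo U (w - b) by move=> t; case: (kwb t).
suff BO : B (w - b) (w - b) = 0 by have := bil_neg HB Uwb wb0; rewrite BO ltxx.
have orth z : frak_p expo U G z -> B z (w - b) = 0.
  by move=> [_ [xi Uxi <-]]; rewrite (bil_sym HB) (bil_orth HB).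
by rewrite Bl !orth // subrr.
Qed.

Variables (Z : complexManifold R) (omega : Z -> tangent Z -> tangent Z -> R).
Hypothesis Homega : kahler_form omega.
Variables (act : UC -> Z -> Z).
Hypothesis Hact : holomorphic_action act.
Variables (mu : Z -> lie UC -> R).
Hypothesis Hmu : momentum_map expo U act omega mu.
Variables (M : set Z) (mup : Z -> lie UC).
Hypothesis Hmup : gradient_map expo U G B mu M mup.

(** On [M] the function is minus the component of [mu] along [J v]. The gradient of that component
    is [J] applied to the field of [J v], that is, minus the field of [v], which vanishes at a fixed
    point. *)
Lemma fixed_critical v z : frak_p expo U G v -> M z ->
  (forall t : R, act (expo (t *: v)) z = z) ->
  critical_on M (fun x => B (mup x) v) z.
Proof.
move=> pv Mz fixz; split=> // gamma sg Mg g0.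
have -> : (fun x => B (mup x) v) \o gamma = - ((mu ^~ (J v)) \o gamma).
  by apply/funext => s /=; rewrite (Hmup (Mg s)).2.
have v0 : fundamental_field expo act v z = 0.
  rewrite /fundamental_field /velocity.
  rewrite (_ : _ \o _ = cst (coord z z)) ?derive1_cst //.
  by apply/funext => t /=; rewrite !fixz.
have dmu : fun_diff (mu ^~ (J v)) (gamma 0) (velocity gamma 0) = 0.
  rewrite (momentum_gradient Hmu) ?g0; last exact: lie_alg_J.
  rewrite (fundamental_fieldJ exp_expo Hact) v0 /kahler_metric JJ oppr0.
  (* With scalar 1 and zero vectors, linearity says that the value of the form at 0 is twice itself,
     hence 0. *)
  have := form_linear Homega z 1 0 0 (J (velocity gamma 0)).
  rewrite scale1r addr0 mul1r => /eqP; rewrite eq_sym -subr_eq0 addrK.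
  by move/eqP.
have dm := is_derive_smooth_fun 0 (momentum_smooth Hmu (lie_alg_J pv)) sg.
by rewrite dmu in dm; have := is_deriveN dm; rewrite oppr0.
Qed.

Variables (Psi : Z -> UC -> R).
Hypothesis HPsi : kempf_ness expo U G B act M mup Psi.

(** The curve [expo (s *: v)] lies in [G], its right-trivialized velocity is [v] at every time, and
    [pi_p] fixes [v]. *)
Lemma is_derive_kempf_ness v z (t : R) :
  subgroup G -> subgroup U -> frak_p expo U G v -> M z ->
  is_derive t (1 : R) (fun s : R => Psi z (expo (s *: v)))
    (B (mup (act (expo (t *: v)) z)) v).
Proof.
move=> sG sU pv Mz; have [_ dPsi] := HPsi Mz.
have Gv s : G (expo (s *: v)) by case: pv.
pose gamma s := expo (s *: v).
have := dPsi _ (Gv t) (gamma \o shift t).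
rewrite velocity_translate /= add0r right_trivialized_velocity_expo // pi_p_id //.
move=> dP; rewrite -[t in is_derive t]add0r.
apply: is_derive_translate; apply: dP => // [|s]; last exact: Gv.
exact/smooth_curve_translate/smooth_expo.
Qed.

End GradientMap.

(** * Derivatives and limits under the integral sign, for [F] with bounded time derivative [h]
    tending to [l] *)

Lemma continuous_borel_measurable {R : realType} (X : ptopologicalType) (f : X -> R) :
  continuous f -> measurable_fun setT (f : g_sigma_algebraType (@open X) -> R).
Proof.
move=> /continuousP cf.
apply: (measurability _ (RGenOpens.measurableE R)).
move=> _ [_ [a [b ->] <-]]; rewrite setTI.
apply: sub_sigma_algebra; apply: cf; exact: interval_open.
Qed.

Section IntegratedFlow.
Context {R : realType} {X : ptopologicalType}.
Local Notation BX := (g_sigma_algebraType (@open X)).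
Variables (nu : probability BX R) (F h : R -> X -> R) (l : X -> R) (C : R).
Hypothesis F0 : forall x, F 0 x = 0.
Hypothesis dF : forall (t : R) x, is_derive t (1 : R) (F ^~ x) (h t x).
Hypothesis ch : continuous (fun w : R * X => h w.1 w.2).
Hypothesis hC : forall t x, `|h t x| <= C.
Hypothesis hl : forall x, h t x @[t --> +oo] --> l x.

Let C_ge0 : 0 <= C.
Proof. exact: le_trans (hC 0 point). Qed.

Let cF x : continuous (F ^~ x).
Proof.
move=> t; apply: differentiable_continuous; apply/derivable1_diffP.
by case: (dF t x).
Qed.

(** Mean value theorem for [F ^~ x - F ^~ y], which vanishes at time 0. *)
Let F_lipschitz (t : R) x y (e : R) : 0 <= t ->
  (forall s, `[0, t]%classic s -> `|h s x - h s y| <= e) ->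
  `|F t x - F t y| <= e * t.
Proof.
move=> t0 he.
have dD s : s \in `]0, t[ -> is_derive s (1 : R) (F ^~ x - F ^~ y) (h s x - h s y).
  by move=> _; apply: is_deriveB.
have cD : {within `[0, t], continuous (F ^~ x - F ^~ y)}.
  by apply: continuous_subspaceT => s; apply: continuousB; exact: cF.
have [s st] := MVT_segment t0 dD cD.
rewrite !fctE !F0 !subr0 => ->; rewrite normrM (ger0_norm t0).
by apply: ler_wpM2r => //; exact: he.
Qed.

Let F_bound (t : R) x : 0 <= t -> `|F t x| <= C * t.
Proof.
move=> t0.
have [s _] : exists2 s, s \in `[0, t] & F t x - F 0 x = h s x * (t - 0).
  by apply: (MVT_segment t0); apply: continuous_subspaceT => s; exact: cF.
rewrite F0 !subr0 => ->; rewrite normrM (ger0_norm t0).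
by apply: ler_wpM2r => //; exact: hC.
Qed.

(** Continuity in the space variable is recovered from the joint continuity of [h]: over the compact
    time interval, [h s y] is uniformly close to [h s x] for [y] near [x]. *)
Let continuous_F (t : R) : 0 <= t -> continuous (F t).
Proof.
move=> t0 x; apply/cvgrPdist_lt => e e0.
(* Dividing by [t + 1] instead of [t] covers [t = 0] and makes the final bound [d * t < e]
   strict. *)
have t1 : 0 < t + 1 by rewrite ltr_pwDr.
pose d := e / (t + 1).
have d0 : 0 < d by rewrite divr_gt0.
(* Compactness turns the estimates near each [(s, x)] into one neighbourhood of [x] valid for all
   [s] in the segment. *)
have /compact_near_coveringP nc := @segment_compact R 0 t.
have : \forall y \near x, `[0, t]%classic `<=` (fun s => `|h s x - h s y| < d).
  apply: (nc _ _ (fun y s => `|h s x - h s y| < d)) => s _.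
  pose g := (fun w : R * X => h w.1 x) - (fun w => h w.1 w.2).
  have cg : {for (s, x), continuous g}.
    apply: continuousB; last exact: ch.
    apply: (@continuous_comp _ _ _ fst (h ^~ x)); first exact: cvg_fst.
    apply: (@continuous_comp _ _ _ (fun t : R => (t, x)) (fun w => h w.1 w.2)).
      by apply: (cvg_pair (G := nbhs s) (H := nbhs x)); [exact: cvg_id|exact: cvg_cst].
    exact: ch.
  have g0 : g (s, x) = 0 by rewrite /g !fctE subrr.
  move/cvgrPdist_lt : cg => /(_ d d0).
  by rewrite g0; apply: filterS => -[s' y]; rewrite /g !fctE sub0r normrN.
apply: filterS => y hy.
apply: (@le_lt_trans _ _ (d * t)).
  by apply: F_lipschitz => // s /hy /ltW.
by rewrite /d mulrAC ltr_pdivrMr // ltr_pM2l // ltrDl.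
Qed.

Let continuous_h t : continuous (h t).
Proof.
move=> x; apply: (@continuous_comp _ _ _ (fun y => (t, y)) (fun w => h w.1 w.2)).
  by apply: (cvg_pair (G := nbhs t) (H := nbhs x)); [exact: cvg_cst|exact: cvg_id].
exact: ch.
Qed.

Let bounded_integrable (f : BX -> R) (D : R) : measurable_fun setT f ->
  (forall x, `|f x| <= D) -> nu.-integrable setT (EFin \o f).
Proof.
move=> mf fD; apply: measurable_bounded_integrable => //.
  by rewrite ltey_eq fin_num_measure.
by exists D; split=> [|M DM x _]; [exact: num_real|exact: le_trans (fD x) (ltW DM)].
Qed.

(** Along integer times, [l] is a pointwise limit of a sequence of continuous functions. *)
Lemma measurable_flow_limit : measurable_fun setT (l : BX -> R).
Proof.
apply: (measurable_fun_cvg (h := fun n => h n%:R : BX -> R)) => [n|x _].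
  by apply: continuous_borel_measurable; exact: continuous_h.
have /cvg_pinftyP hx : (h ^~ x) t @[t --> +oo] --> l x by exact: hl.
exact: (hx (fun n => n%:R) cvgr_idn).
Qed.

Let l_bound x : `|l x| <= C.
Proof.
have hn : `|h t x| @[t --> +oo] --> `|l x| by apply: cvg_norm; exact: hl.
by apply: (cvgr_to_le hn); apply: nearW => t; exact: hC.
Qed.

Lemma integrable_flow_limit : nu.-integrable setT (EFin \o (l : BX -> R)).
Proof. exact: bounded_integrable measurable_flow_limit l_bound. Qed.

Lemma derive1_Rintegral_flow (t : R) : 0 < t ->
  derive1 (fun s => Rintegral nu setT (F s : BX -> R)) t =
  Rintegral nu setT (h t : BX -> R).
Proof.
move=> t0.
have d1 s x : partial1of2 F s x = h s x.
  by rewrite /partial1of2 derive1E; have [_ ->] := dF s x.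
(* The interval from 0 to [t + 1] is a neighbourhood of [t] inside the positive times, where [F s]
   is known to be continuous and bounded by [C * s]. The constant [C] dominates the derivative and
   is integrable for a probability. *)
rewrite (@differentiation_under_integral R _ BX nu F setT measurableT t 0 (t + 1)
  _ _ _ (cst C)) //.
- by apply: eq_Rintegral => x _; exact: d1.
- by rewrite /= in_itv /= t0 ltrDl ltr01.
- move=> s /=; rewrite in_itv /= => /andP[s0 _].
  apply: (bounded_integrable (D := C * s)).
    by apply: continuous_borel_measurable; apply: continuous_F; exact: ltW.
  by move=> x; apply/F_bound/ltW.
- exact: finite_measure_integrable_cst.
- by move=> s x _ _; rewrite d1; exact: hC.
Qed.

Lemma lim_derive1_Rintegral_flow :
  lim (derive1 (fun s => Rintegral nu setT (F s : BX -> R)) t @[t --> +oo]) =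
  Rintegral nu setT (l : BX -> R).
Proof.
apply/cvg_lim => //.
have near_eq : \forall t \near +oo, Rintegral nu setT (h t : BX -> R) =
    derive1 (fun s => Rintegral nu setT (F s : BX -> R)) t.
  exists 0; split=> // t t0; exact/esym/derive1_Rintegral_flow.
apply: cvg_trans (near_eq_cvg near_eq) _.
(* Dominated convergence concerns sequences, so the limit is tested along an arbitrary sequence of
   times [u] tending to infinity. *)
apply/cvg_pinftyP => u uy.
have meas_h n : measurable_fun setT (fun x : BX => (h (u n) x)%:E).
  apply/measurable_EFinP; apply: continuous_borel_measurable; exact: continuous_h.
have [_ _ cvg_h] : [/\ nu.-integrable setT (EFin \o (l : BX -> R)),
    [sequence \int[nu]_(x in setT) `|(h (u n) x)%:E - (l x)%:E|]_n @ \oo --> 0 &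
    [sequence \int[nu]_(x in setT) (h (u n) x)%:E]_n @ \oo -->
      \int[nu]_(x in setT) (l x)%:E]%E.
  apply: (dominated_convergence _ meas_h) => //.
  - by apply/measurable_EFinP; exact: measurable_flow_limit.
  - apply: aeW => x _; apply: cvg_EFin; first exact: nearW.
    have /cvg_pinftyP hx : (h ^~ x) t @[t --> +oo] --> l x by exact: hl.
    exact: hx.
  - exact: (finite_measure_integrable_cst nu C).
  - by apply: aeW => x n _; rewrite /= lee_fin; exact: hC.
apply: fine_cvg; rewrite /Rintegral fineK //.
exact: (integrable_fin_num measurableT integrable_flow_limit).
Qed.


End IntegratedFlow.

(** * Integrals of functions with finitely many values *)

(** As [c] is injective, the level sets are disjoint, and [l] is the combination of their indicators
    with coefficients [c i]. *)
Lemma Rintegral_finite_values {R : realType} d (T : measurableType d)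
    (nu : probability T R) (l : T -> R) (r : nat) (c : 'I_r -> R) :
  measurable_fun setT l -> injective c -> (forall x, range c (l x)) ->
  Rintegral nu setT l = \sum_(i < r) c i * fine (nu [set x | l x = c i]).
Proof.
move=> ml inj_c lc; pose W i := [set x | l x = c i].
have mW i : measurable (W i).
  rewrite (_ : W i = setT `&` l @^-1` [set c i]) ?setTI //.
  by rewrite -[X in measurable X]setTI; exact: ml.
have lE x : l x = \sum_(i < r) c i * \1_(W i) x.
  have [i _ ci] := lc x; rewrite (bigD1 i) //= big1 ?addr0 => [|j ji].
    by rewrite indicE mem_set ?mulr1 // /W /= ci.
  rewrite indicE memNset ?mulr0 // /W /= -ci => /inj_c ij.
  by rewrite ij eqxx in ji.
have int1 i : nu.-integrable setT (fun x => (\1_(W i) x)%:E).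
  exact: integrable_indic.
rewrite /Rintegral.
under eq_integral => x _ do rewrite lE -sumEFin.
rewrite (integral_sum measurableT (f := fun i x => (c i * \1_(W i) x)%:E)); last first.
  by move=> i; exact: (integrableZl measurableT (c i) (int1 i)).
have intW i : (\int[nu]_x (c i * \1_(W i) x)%:E = (c i * fine (nu (W i)))%:E)%E.
  under eq_integral do rewrite EFinM.
  rewrite (integralZl measurableT (int1 i)) integral_indic // setIT.
  by rewrite EFinM fineK // fin_num_measure.
by under eq_bigr do rewrite intW; rewrite sumEFin.
Qed.

(** * The maximal weight as a sum over critical values *)

Theorem theorem53 (R : realType)
    (UC : complexLieGroup R) (expo : lie UC -> UC) (Hexpo : exponential_map expo)
    (U : set UC) (HUgrp : subgroup U) (HUcompact : compact U)
    (HUconn : connected U) (HUC : complexification U)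
    (Z : complexManifold R) (omega : Z -> tangent Z -> tangent Z -> R)
    (Homega : kahler_form omega)
    (act : UC -> Z -> Z) (Hact : holomorphic_action act)
    (HomegaU : invariant_form U act omega)
    (mu : Z -> lie UC -> R) (Hmu : momentum_map expo U act omega mu)
    (G : set UC) (HGgrp : subgroup G) (HGclosed : closed G)
    (HGconn : connected G) (HGcompat : compatible expo U G)
    (B : lie UC -> lie UC -> R) (HB : invariant_bilinear_form expo U B)
    (M : set Z) (x0 : M) (HMsub : submanifold M) (HMcompact : compact M)
    (HMstable : forall g x, G g -> M x -> M (act g x))
    (mup : Z -> lie UC) (Hmup : gradient_map expo U G B mu M mup)
    (Psi : Z -> UC -> R) (HPsi : kempf_ness expo U G B act M mup Psi)
    (nu : probability (borel x0) R)
    (e : lie UC -> boundary expo U G B) (He : boundary_param e)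
    (lambda : boundary expo U G B -> R) (Hlambda : maximal_weight Psi nu e lambda)
    (v : lie UC) (Hv : unit_p expo U G B v)
    (alpha : M -> M) (Halpha : limit_map expo act v alpha)
    (r : nat) (c : 'I_r -> R)
    (Hcdecr : forall i j : 'I_r, (i < j)%N -> c j < c i)
    (Hccrit : range c =
      [set B (mup x) v | x in critical_on M (fun x => B (mup x) v)]) :
  lambda (e (- v)) =
    \sum_(i < r) c i * fine (nu (unstable (fun x => B (mup x) v) alpha (c i))).
Proof.
have pv : frak_p expo U G v by case: Hv.
have Gv (t : R) : G (expo (t *: v)) by case: pv.
(* Since [mup] is constrained only on [M], it is replaced by a function that is smooth on all of [Z]
   and agrees with the component of [mup] along [v] on [M]. *)
pose f z := - mu z (J v).
have fE z : M z -> B (mup z) v = f z by move=> /Hmup[_ /(_ v pv)].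
have cf : continuous f.
  move=> z; apply: continuousN; apply: smooth_fun_continuous.
  by apply: (momentum_smooth Hmu); exact: lie_alg_J pv.
have [C fC] : exists C : R, forall z, M z -> `|f z| <= C.
  have /compact_bounded[C [_ fC]] : compact (f @` M).
    by apply: continuous_compact => //; exact: continuous_subspaceT.
  (* Boundedness supplies the estimate for every constant strictly above [C], hence [C + 1]. *)
  by exists (C + 1) => z Mz; apply: (fC (C + 1)); [rewrite ltrDl|exists z].
pose X := pointed_sub x0.
have MX (x : X) : M (val (x : M)) by exact/set_mem/valP.
pose F (t : R) (x : X) := Psi (val (x : M)) (expo (t *: v)).
pose h (t : R) (x : X) := f (act (expo (t *: v)) (val (x : M))).
pose l (x : X) := f (val (alpha x)).
have Mh (t : R) (x : X) : M (act (expo (t *: v)) (val (x : M))).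
  by apply: HMstable.
have F0 x : F 0 x = 0 by rewrite /F expo0 //; case: (HPsi _ (MX x)).
have dF (t : R) x : is_derive t (1 : R) (F ^~ x) (h t x).
  by rewrite /h -fE //; exact: (is_derive_kempf_ness Hexpo HB HPsi).
have ch : continuous (fun w : R * X => h w.1 w.2).
  move=> w; apply: (@continuous_comp _ _ _ (fun w : R * X => (w.1, val (w.2 : M)))
    (fun w : R * Z => f (act (expo (w.1 *: v)) w.2))).
    apply: (cvg_pair (G := nbhs w.1) (H := nbhs (val (w.2 : M)))); first exact: cvg_fst.
    apply: (@continuous_comp _ _ _ snd (fun x : X => val (x : M))); first exact: cvg_snd.
    exact: initial_continuous.
  apply: (@continuous_comp _ _ _ (fun w : R * Z => act (expo (w.1 *: v)) w.2) f).
    exact: (continuous_flow Hexpo Hact).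
  exact: cf.
have hC t x : `|h t x| <= C by exact: fC.
have hl x : h t x @[t --> +oo] --> l x.
  apply: (@cvg_comp _ _ _ (fun t : R => act (expo (t *: v)) (val (x : M))) f).
    exact: Halpha.
  exact: cf.
have alpha_crit (x : M) : critical_on M (fun z => B (mup z) v) (val (alpha x)).
  have fix_alpha t : act (expo (t *: v)) (val (alpha x)) = val (alpha x).
    exact: (flow_limit_fixed Hexpo Hact t (Halpha x)).
  exact: (fixed_critical Hexpo Homega Hact Hmu Hmup pv (MX (alpha x)) fix_alpha).
have lE x : l x = B (mup (val (alpha x))) v by rewrite fE //; exact/set_mem/valP.
rewrite (Hlambda (- v)); last exact: unit_p_opp.
transitivity (Rintegral nu setT (l : borel x0 -> R)).
  rewrite -(lim_derive1_Rintegral_flow nu F0 dF ch hC hl).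
  (* The sign in the definition of the weight cancels the one in [- v], leaving the forward flow of
     [v]. *)
  suff -> : (fun t : R => PsiP Psi nu (expo (- t *: - v))) =
      (fun t => Rintegral nu setT (F t : borel x0 -> R)) by [].
  by apply/funext => t; rewrite /PsiP scaleNr scalerN opprK.
have inj_c : injective c.
  move=> i j cij; apply/val_inj; case: (ltngtP i j) => // /Hcdecr.
    by rewrite cij ltxx.
  by rewrite cij ltxx.
have lc x : range c (l x) by rewrite Hccrit lE; exists (val (alpha x)).
apply: etrans (Rintegral_finite_values nu (measurable_flow_limit ch hl) inj_c lc) _.
apply: eq_bigr => i _; congr (_ * fine (nu _)).
(* The unstable set also asks that [alpha x] be critical; [alpha_crit] provides this for every [x],
   so the set is just a level set of [l]. *)
apply/seteqP; split=> x /=; rewrite /crit_level /= lE; last by case.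
by move=> lx; split.
Qed.
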